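(* Let a price function $P:\mathbb{N}_{\ge 1}\to\mathbb{R}_{\ge 0}$ be given. All basic zone tariffs with respect to $P$ (on all PTNs with zone partitions) satisfy the no-stopover property if and only if $$P(k)\le P(i)+P(k-i+1)\quad\text{for all } k\in\mathbb{N}_{\ge 1},\ i\in\{1,\dots,k\}.$$ In particular, if all basic zone tariffs with respect to $P$ satisfy the no-stopover property, then $P(k)\le (k-1)P(2)$ for all $k\ge 2$.
   Context: A PTN is a finite, simple, connected, undirected graph $(V,E)$. A path is a finite sequence $(x_1,\dots,x_n)$, $n\ge 1$, of (not necessarily distinct) nodes with consecutive nodes adjacent; $\mathcal{W}$ is the set of all paths; $[x_i,x_j]$ denotes the subpath $(x_i,\dots,x_j)$. A fare structure is a function $p:\mathcal{W}\to\mathbb{R}_{\ge 0}$. A zone partition $\mathcal{Z}$ is a partition of $V$ into nonempty sets called zones. The zone border weight of an edge $e=\{x,y\}$ is $b(e)=0$ if $x,y$ lie in the same zone and $b(e)=1$ otherwise. For a path $W=(x_1,\dots,x_n)$ put $z(W)=1+\sum_{i=1}^{n-1}b(x_i,x_{i+1})$ (number of traversed zones, counted with multiplicity). A fare structure $p$ is a basic zone tariff with respect to $P$ if $p(W)=P(z(W))$ for all $W\in\mathcal{W}$. No-stopover property: $p([x_1,x_n])\le p([x_1,x_i])+p([x_i,x_n])$ for all paths $(x_1,\dots,x_n)\in\mathcal{W}$, $n\ge 3$, and all $i\in\{2,\dots,n-1\}$. *)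

(* Defs.v *)
From HB Require Import structures.
From mathcomp Require Import all_boot all_order all_algebra.
From mathcomp Require Import reals.

Set Implicit Arguments.
Unset Strict Implicit.
Unset Printing Implicit Defensive.

Import Order.TTheory GRing.Theory Num.Theory.
Local Open Scope ring_scope.

Record ptn := PTN {
  node :> finType;
  adj : rel node;
  adj_sym : symmetric adj;
  adj_irr : irreflexive adj;
  adj_connected : forall x y : node, connect adj x y
}.

(* Nodes may repeat along a path, and one-node paths are allowed. *)
Record ptn_path (G : ptn) := PtnPath {
  path_nodes :> seq G;
  path_nodesP : (1 <= size path_nodes)%N && sorted (@adj G) path_nodes
}.

HB.instance Definition _ (G : ptn) := [isSub for @path_nodes G].

(* [subpath W i j] is [x_i, x_j] for W = (x_1, ..., x_n), with indices starting
   from 1.  [insubd] returns W itself when the sublist is not a path, which by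
   [subpathE] does not happen for 1 <= i <= j <= n. *)
Definition subpath (G : ptn) (W : ptn_path G) (i j : nat) : ptn_path G :=
  insubd W (take (j - i + 1) (drop (i - 1) W)).

Lemma subpathE (G : ptn) (W : ptn_path G) (i j : nat) :
  (1 <= i)%N -> (i <= j)%N -> (j <= size W)%N ->
  path_nodes (subpath W i j) = take (j - i + 1) (drop (i - 1) W).
Proof.
move=> i1 ij jn; rewrite /subpath; apply: (insubdK W).
case: W jn => s /= /andP[_ sP] jn; rewrite unfold_in /=.
rewrite take_sorted ?drop_sorted // andbT size_takel ?size_drop ?addn1 //.
case: i i1 ij => // i _ ij; rewrite subSS subn0 subnSK //; exact: leq_sub2r.
Qed.

Record fare_structure (R : realType) (G : ptn) := FareStructure {
  fare :> ptn_path G -> R;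
  fare_ge0 : forall W, 0 <= fare W
}.

Definition border_weight (G : ptn) (Z : {set {set G}}) (x y : G) : nat :=
  if [exists A in Z, (x \in A) && (y \in A)] then 0%N else 1%N.

(* [zip W (behead W)] lists the consecutive pairs (x_i, x_(i+1)). *)
Definition zones (G : ptn) (Z : {set {set G}}) (W : ptn_path G) : nat :=
  (1 + \sum_(e <- zip W (behead W)) border_weight Z e.1 e.2)%N.

Definition basic_zone_tariff (R : realType) (G : ptn) (Z : {set {set G}})
    (P : nat -> R) (p : fare_structure R G) : Prop :=
  forall W : ptn_path G, p W = P (zones Z W).

Definition no_stopover (R : realType) (G : ptn) (p : fare_structure R G) : Prop :=
  forall W : ptn_path G, (3 <= size W)%N ->
  forall i : nat, (2 <= i <= size W - 1)%N ->
    p (subpath W 1 (size W)) <= p (subpath W 1 i) + p (subpath W i (size W)).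

Definition all_basic_zone_tariffs_no_stopover (R : realType) (P : nat -> R) :
    Prop :=
  forall (G : ptn) (Z : {set {set G}}), partition Z [set: G] ->
  forall p : fare_structure R G, basic_zone_tariff Z P p -> no_stopover p.

(* Main.v *)
Require Import Defs.
From mathcomp Require Import all_boot all_order all_algebra.
From mathcomp Require Import reals.
Import Order.TTheory GRing.Theory Num.Theory.
Local Open Scope ring_scope.

(** A stopover at a node of a path cuts its edges into two groups, so the zone
    counts satisfy [z(W) + 1 = z(W1) + z(W2)]: the zone of the stopover is
    counted in both parts ([zones_split]).  With [k = z(W)] and [i = z(W1)] this
    says [z(W2) = k - i + 1], so the inequality on [P] gives no-stopover.

    Conversely, it suffices to realise every pair [1 < i < k] by one path with
    a stopover.  When every zone is a single node, each edge crosses a border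
    and [z(W)] is the number of nodes of [W] ([zones_singletons]).  As paths may
    repeat nodes, a single edge with its two endpoints in different zones is
    already enough: the path that goes back and forth along it for [k] nodes,
    stopped at its [i]-th node, has zone counts [k], [i] and [k - i + 1].  The
    extreme cases [i = 1] and [i = k] follow from [P 1 >= 0].

    The linear bound comes from iterating the instance [i = k - 1], that is
    [P k <= P (k - 1) + P 2]. *)

(** The element at which a sequence is cut ends one part and starts the other,
    so each consecutive pair falls in exactly one part. *)
Lemma sum_consecutive_split (T : Type) (f : T * T -> nat) (s : seq T) (i : nat) :
  (i < size s)%N ->
  (\sum_(e <- zip s (behead s)) f e =
   \sum_(e <- zip (take i.+1 s) (behead (take i.+1 s))) f e +
   \sum_(e <- zip (drop i s) (behead (drop i s))) f e)%N.
Proof.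
elim: s i => [|x [|y s] IHs] [|i] //= lt_i_s; rewrite ?take0 ?big_nil //.
by rewrite !big_cons -addnA -(IHs i lt_i_s).
Qed.

Lemma subpath_full (G : ptn) (W : ptn_path G) : subpath W 1 (size W) = W.
Proof.
have W_gt0 : (1 <= size W)%N by case/andP: (path_nodesP W).
by apply: val_inj; rewrite /= subpathE // subnK // drop0 take_size.
Qed.

Lemma subpath_prefix (G : ptn) (W : ptn_path G) (i : nat) :
  (1 <= i <= size W)%N -> path_nodes (subpath W 1 i) = take i W.
Proof. by case/andP=> i_gt0 le_iW; rewrite subpathE // subnK // drop0. Qed.

Lemma subpath_suffix (G : ptn) (W : ptn_path G) (i : nat) :
  (1 <= i <= size W)%N -> path_nodes (subpath W i (size W)) = drop i.-1 W.
Proof.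
case/andP=> i_gt0 le_iW; rewrite subpathE // take_oversize subn1 //.
by rewrite size_drop; case: i i_gt0 le_iW => //= i _ lt_iW; rewrite addn1 subnSK.
Qed.

Lemma zones_split (G : ptn) (Z : {set {set G}}) (W : ptn_path G) (i : nat) :
  (1 <= i <= size W)%N ->
  (zones Z W).+1 =
  (zones Z (subpath W 1 i) + zones Z (subpath W i (size W)))%N.
Proof.
move=> iW; rewrite /zones subpath_prefix // subpath_suffix //.
case: i iW => //= i lt_iW.
by rewrite (sum_consecutive_split _ _ _ _ lt_iW) addnACA.
Qed.

Definition singletons (T : finType) : {set {set T}} := [set [set x] | x : T].

Lemma partition_singletons (T : finType) : partition (singletons T) [set: T].
Proof.
apply/and3P; split.
- rewrite eqEsubset subsetT; apply/subsetP=> x _.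
  by apply/bigcupP; exists [set x]; rewrite ?set11 ?imset_f.
- apply/trivIsetP=> _ _ /imsetP[x _ ->] /imsetP[y _ ->] neq_xy.
  by rewrite disjoints1 inE; apply: contraNneq neq_xy => ->.
- by apply/imsetP=> -[x _ /setP/(_ x)]; rewrite !inE eqxx.
Qed.

Lemma border_weight_singletons (G : ptn) (x y : G) :
  border_weight (singletons G) x y = (x != y).
Proof.
rewrite /border_weight; case: exists_inP => [[_ /imsetP[z _ ->]]|no_zone].
  by rewrite !inE => /andP[/eqP-> /eqP->]; rewrite eqxx.
case: eqP => // eq_xy; case: no_zone; exists [set x]; first exact: imset_f.
by rewrite -eq_xy set11.
Qed.

(** Adjacency is irreflexive, so every edge joins two different singleton
    zones. *)
Lemma zones_singletons (G : ptn) (W : ptn_path G) :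
  zones (singletons G) W = size W.
Proof.
rewrite /zones; case: W => -[|x s] //= adj_s; congr _.+1.
elim: s x adj_s => [|y s IHs] x /=; first by rewrite big_nil.
case/andP=> adj_xy /IHs; rewrite big_cons /= => ->.
rewrite border_weight_singletons (contraTneq _ adj_xy) // => ->.
by rewrite adj_irr.
Qed.

Lemma neq_sym_rel (T : eqType) : symmetric (fun x y : T => x != y).
Proof. by move=> x y; rewrite eq_sym. Qed.

Lemma neq_irr_rel (T : eqType) : irreflexive (fun x y : T => x != y).
Proof. by move=> x; rewrite eqxx. Qed.

Lemma neq_connected (T : finType) (x y : T) :
  connect (fun x y : T => x != y) x y.
Proof. by case: (eqVneq x y) => [->|]; [exact: connect0 | exact: connect1]. Qed.

Definition single_edge : ptn :=
  @PTN bool (fun x y => x != y) (@neq_sym_rel _) (@neq_irr_rel _)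
    (@neq_connected _).

Lemma alternating_pathP (n : nat) :
  (1 <= size (traject negb true n.+1))%N &&
  sorted (@adj single_edge) (traject negb true n.+1).
Proof.
rewrite size_traject /=; apply: sub_path (fpath_traject negb true n).
by move=> x y /= /eqP <-; case: x.
Qed.

Definition alternating_path (n : nat) : ptn_path single_edge :=
  @PtnPath single_edge _ (alternating_pathP n).

Lemma size_alternating_path (n : nat) : size (alternating_path n) = n.+1.
Proof. exact: size_traject. Qed.

Section PriceFunction.
Variables (R : realType) (P : nat -> R).

Lemma no_stopover_of_price :
  (forall k : nat, (1 <= k)%N -> forall i : nat, (1 <= i <= k)%N ->
     P k <= P i + P (k - i + 1)%N) ->
  all_basic_zone_tariffs_no_stopover P.
Proof.
move=> leP G Z _ p pE W W_ge3 i /andP[i_ge2 le_iW].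
have iW : (1 <= i <= size W)%N.
  by rewrite (ltnW i_ge2) (leq_trans le_iW) ?leq_subr.
have := zones_split _ Z W i iW; rewrite subpath_full !pE.
set k := zones Z W; set a := zones Z (subpath W 1 i).
set b := zones Z (subpath W i (size W)) => k_split.
have b_gt0 : (0 < b)%N by [].
have le_ak : (a <= k)%N by rewrite -ltnS k_split -addn1 leq_add2l.
have -> : b = (k - a + 1)%N by rewrite addn1 -subSn // k_split addKn.
by apply: leP => //; rewrite le_ak.
Qed.

Hypothesis P_ge0 : forall k : nat, (1 <= k)%N -> 0 <= P k.

Definition zone_tariff (G : ptn) (Z : {set {set G}}) : fare_structure R G :=
  @FareStructure R G (fun W => P (zones Z W)) (fun W => P_ge0 (zones Z W) isT).

Lemma price_of_no_stopover :
  all_basic_zone_tariffs_no_stopover P ->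
  forall k : nat, (1 <= k)%N -> forall i : nat, (1 <= i <= k)%N ->
    P k <= P i + P (k - i + 1)%N.
Proof.
move=> all_ns k k_gt0 i /andP[i_gt0 le_ik].
have P1_ge0 : 0 <= P 1%N by exact: P_ge0.
(* An endpoint is not a stopover, so these two cases are not instances of the
   property. *)
have [->|i_neq1] := eqVneq i 1%N; first by rewrite subnK // lerDr.
have [->|i_neqk] := eqVneq i k; first by rewrite subnn lerDl.
have i_ge2 : (2 <= i)%N by rewrite ltn_neqAle eq_sym i_neq1.
have lt_ik : (i < k)%N by rewrite ltn_neqAle i_neqk.
case: k k_gt0 le_ik i_neqk lt_ik => // n _ le_ik _ lt_ik.
pose W := alternating_path n; have sizeW : size W = n.+1.
  exact: size_alternating_path.
have iW : (1 <= i <= size W)%N by rewrite sizeW i_gt0.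
have := all_ns _ _ (partition_singletons _) (zone_tariff _ (singletons _))
  (fun W => erefl) W.
rewrite {1}sizeW => /(_ (leq_ltn_trans i_ge2 lt_ik) i).
rewrite {1}sizeW subn1 i_ge2 => /(_ lt_ik).
rewrite subpath_full /= !zones_singletons subpath_prefix // subpath_suffix //.
rewrite size_take_min size_drop sizeW (minn_idPl le_ik).
case: i i_gt0 {i_neq1 i_ge2 le_ik iW} lt_ik => //= i _ lt_in.
by rewrite addn1 subnSK // ltnW.
Qed.

Lemma price_linear_bound :
  (forall k : nat, (1 <= k)%N -> forall i : nat, (1 <= i <= k)%N ->
     P k <= P i + P (k - i + 1)%N) ->
  forall k : nat, (2 <= k)%N -> P k <= (k - 1)%:R * P 2%N.
Proof.
move=> leP [|[|k]] // _; rewrite subn1 /=.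
elim: k => [|k IHk]; first by rewrite mul1r.
apply: le_trans (leP k.+3 isT k.+2 _) _; first by rewrite /= leqnSn.
by rewrite subSnn -[k.+2%:R]natr1 mulrDl mul1r lerD2r.
Qed.

End PriceFunction.

Theorem theorem17 (R : realType) (P : nat -> R)
    (P_ge0 : forall k : nat, (1 <= k)%N -> 0 <= P k) :
  (all_basic_zone_tariffs_no_stopover P <->
   (forall k : nat, (1 <= k)%N -> forall i : nat, (1 <= i <= k)%N ->
      P k <= P i + P (k - i + 1)%N))
  /\
  (all_basic_zone_tariffs_no_stopover P ->
   forall k : nat, (2 <= k)%N -> P k <= (k - 1)%:R * P 2%N).
Proof.
split; last by move/(price_of_no_stopover _ _ P_ge0)/price_linear_bound.
by split; [exact: price_of_no_stopover | exact: no_stopover_of_price].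
Qed.
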